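(* Let $K$ be a field and let $I_1,\dots,I_t\subset S=K[x_1,\dots,x_n]$ be proper nonzero monomial ideals with pairwise disjoint supports. Suppose that $\mathrm{v}(I_j^k)=\alpha(I_j)k-1$ for all $k\gg0$ and all $j=1,\dots,t$. Then, for all $k\ge1$, $$\mathrm{v}\Bigl(\bigl(\sum_{j=1}^tI_j\bigr)^k\Bigr)\ \ge\ \bigl(\min_{1\le j\le t}\alpha(I_j)\bigr)k+\Bigl(\sum_{j=1}^t\alpha(I_j)-\min_{1\le j\le t}\alpha(I_j)-t\Bigr).$$ Moreover, equality holds for all $k\gg0$ if $\alpha(I_1)=\alpha(I_2)=\cdots=\alpha(I_t)$, and equality holds for all $k\ge1$ if $\textup{v-stab}(I_1)=\textup{v-stab}(I_2)=\cdots=\textup{v-stab}(I_t)=1$.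
   Context: $S$ is standard graded. For an ideal $L\subset S$, $\operatorname{Ass}(L)$ denotes the set of associated primes of $S/L$. For a proper graded ideal $L$ and $\mathfrak{p}\in\operatorname{Ass}(L)$, $\mathrm{v}_{\mathfrak{p}}(L)$ is the least degree of a homogeneous polynomial $f$ such that $(L:f)=\mathfrak{p}$, and $\mathrm{v}(L)=\min_{\mathfrak{p}\in\operatorname{Ass}(L)}\mathrm{v}_{\mathfrak{p}}(L)$. The initial degree $\alpha(L)$ of a nonzero graded ideal $L$ is the least degree of a nonzero homogeneous element of $L$. For a monomial ideal $L$, $\mathcal{G}(L)$ is its minimal monomial generating set; the support of a monomial $u$ is the set of variables dividing $u$, and the support of $L$ is $\operatorname{supp}(L)=\bigcup_{u\in\mathcal{G}(L)}\operatorname{supp}(u)$. It is known that for a graded ideal $L$ there is a unique linear function $f(k)=ak+b$ with $\mathrm{v}(L^k)=f(k)$ for all $k\gg0$; the $\mathrm{v}$-stability index $\textup{v-stab}(L)$ is the smallest integer $k_0\ge1$ such that $\mathrm{v}(L^k)=f(k)$ for all $k\ge k_0$. ''For all $k\gg0$'' means for all sufficiently large integers $k$. *)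

(* Defs.v *)
From mathcomp Require Import all_boot all_order all_algebra.
From mathcomp Require Import boolp classical_sets.
From mathcomp Require Export mpoly.

Set Implicit Arguments.
Unset Strict Implicit.
Unset Printing Implicit Defensive.

Import GRing.Theory.
Local Open Scope ring_scope.
Local Open Scope classical_set_scope.

(* The least element of a nonempty set of naturals; 0 on the empty set. *)
Definition least (P : set nat) : nat :=
  xget 0%N [set d | P d /\ forall e, P e -> (d <= e)%N].

Section Ideals.
Variables (K : fieldType) (n : nat).
Local Notation S := {mpoly K[n]}.
Implicit Types (L A B p : set S) (f g : S).

(* Unlike [idealr_closed], this allows the unit ideal. *)
Definition is_ideal L : Prop :=
  [/\ L 0, forall f g, L f -> L g -> L (f + g) & forall f g, L g -> L (f * g)].

Definition is_proper_ideal L : Prop := idealr_closed (fun f => f \in L).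

Definition is_prime_ideal L : Prop :=
  is_proper_ideal L /\ prime_idealr_closed (fun f => f \in L).

Definition ideal_gen A : set S := smallest is_ideal A.

Definition ideal_mul A B : set S := ideal_gen [set f * g | f in A & g in B].

Definition ideal_pow L (k : nat) : set S := iter k (ideal_mul L) setT.

Definition ideal_sum (t : nat) (I : 'I_t -> set S) : set S :=
  [set \sum_j f j | f in [set f : 'I_t -> S | forall j, I j (f j)]].

Definition colon L f : set S := [set g | L (g * f)].

(* The annihilator of the class of f in S/L is the colon ideal (L : f). *)
Definition Ass L : set (set S) :=
  [set p | is_prime_ideal p /\ exists f, p = colon L f].

Definition v_at L p : nat :=
  least [set d | exists2 f, f \is d.-homog & colon L f = p].

Definition v_number L : nat := least [set v_at L p | p in Ass L].

Definition initial_degree L : nat :=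
  least [set d | exists f, [/\ L f, f != 0 & f \is d.-homog]].

Definition mon_ideal (M : set 'X_{1..n}) : set S :=
  ideal_gen [set 'X_[m] | m in M].

Definition monomial_ideal L : Prop := exists M, L = mon_ideal M.

Definition min_mon_gens L (M : set 'X_{1..n}) : Prop :=
  mon_ideal M = L /\ forall M', M' `<=` M -> mon_ideal M' = L -> M' = M.

(* The minimal monomial generating set of a monomial ideal (which exists and
   is unique). *)
Definition mingens L : set 'X_{1..n} := xget set0 (min_mon_gens L).

Definition supp L : set 'I_n := [set i | exists2 m, mingens L m & m i != 0%N].

(* If v_number (ideal_pow L k) agrees with a * k + b for all k >= k0, then
   a * k + b is the eventual linear value of the v-function of L. *)
Definition v_stab L : nat :=
  least [set k0 | (1 <= k0)%N /\ exists a b : int, forall k : nat, (k0 <= k)%N ->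
                    (v_number (ideal_pow L k))%:Z = a * k%:Z + b].

End Ideals.

(* Main.v *)
Require Import Defs.
From mathcomp Require Import all_boot all_order all_algebra zify ring.
From mathcomp Require Import boolp classical_sets.

(* For a monomial ideal J, let ord_J(u) be the largest k with u in J^k.  Because
   the supports are disjoint, a monomial u lies in (I_1 + ... + I_t)^k iff the sum
   of the o_j = ord_{I_j}(u) is at least k, and o_j depends only on the part u_j
   of u supported on the variables of I_j; moreover multiplication by a variable
   raises o_j by at most 1.

   Every associated prime of a monomial ideal L is (L : u) for a monomial u, so
   v-numbers may be computed with monomials.  If (I^k : u) is prime, it contains
   a variable x from the support of each I_j; as x u lies in I^k and u does not,
   the o_j sum to k - 1 and x u_j lies in I_j^(o_j + 1), whence
   deg u_j >= alpha(I_j) (o_j + 1) - 1.  Summing over j gives the lower bound.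
   Conversely, if (I_j^(c_j) : u_j) is prime for each j, then o_j = c_j - 1 and
   the product of the (restricted) u_j has a prime colon into I^k for
   k = 1 + sum_j (c_j - 1).  Equality follows by taking all the c_j but one equal
   to a bound from which v(I_j^c) = alpha(I_j) c - 1 holds. *)

Set Implicit Arguments.
Unset Strict Implicit.
Unset Printing Implicit Defensive.

Import Order.TTheory GRing.Theory Num.Theory.
Local Open Scope ring_scope.
Local Open Scope classical_set_scope.

(** * Least elements of sets of naturals *)

Lemma leastP (P : set nat) e : P e ->
  P (least P) /\ forall d, P d -> (least P <= d)%N.
Proof.
move=> Pe; have exP : exists e, `[<P e>] by exists e; exact/asboolP.
apply: (@xgetPex _ 0%N [set d | P d /\ forall e, P e -> (d <= e)%N]).
case: (ex_minnP exP) => d /asboolP Pd dmin.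
by exists d; split=> // c Pc; apply: dmin; exact/asboolP.
Qed.

Lemma least_mem (P : set nat) : P !=set0 -> P (least P).
Proof. by case=> e /leastP[]. Qed.

Lemma least_le (P : set nat) e : P e -> (least P <= e)%N.
Proof. by move=> Pe; case: (leastP Pe) => _; exact. Qed.

(** * Monomial ideals as upward closed sets of exponents *)

Section MonomialSpans.
Variables (K : fieldType) (n : nat).
Local Notation S := {mpoly K[n]}.
Implicit Types (L A B p : set S) (f g : S) (m u : 'X_{1..n}).
Implicit Types (U V : set 'X_{1..n}).

Lemma ideal_gen_ideal A : is_ideal (ideal_gen A).
Proof.
split=> [L [[] //]|f g Lf Lg L hL|f g Lg L hL].
- by case: (hL) => -[_ + _] _; apply; [exact: Lf|exact: Lg].
- by case: (hL) => -[_ _ +] _; apply; exact: Lg.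
Qed.

Lemma ideal_genP A L : is_ideal L -> A `<=` L ->
  (forall J, is_ideal J -> A `<=` J -> L `<=` J) -> ideal_gen A = L.
Proof.
move=> Li AL Lmin; apply/seteqP; split; first exact: smallest_sub.
by apply: Lmin; [exact: ideal_gen_ideal|exact: sub_gen_smallest].
Qed.

Definition upset U := forall m1 m2, U m1 -> U (m1 + m2)%MM.

(** For upward closed [U] this is the monomial ideal whose monomials are exactly those with exponent
    in [U]. Ideal operations then become operations on sets of exponents. *)
Definition mspan U : set S := [set f | forall m, m \in msupp f -> U m].

Lemma mspanX U m : mspan U 'X_[m] <-> U m.
Proof.
split=> [|Um k]; first by apply; rewrite msuppX mem_seq1.
by rewrite msuppX mem_seq1 => /eqP ->.
Qed.

Lemma mspan_ideal U : upset U -> is_ideal (mspan U).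
Proof.
move=> upU; split=> [m|f g Uf Ug m|f g Ug m]; first by rewrite msupp0.
- by move=> /msuppD_le; rewrite mem_cat => /orP[/Uf|/Ug].
- by move=> /msuppM_le /allpairsP[[a b] /= [_ /Ug Ub ->]]; rewrite addmC; apply: upU.
Qed.

Lemma ideal_sum_closed L (T : eqType) (r : seq T) (F : T -> S) : is_ideal L ->
  (forall i, i \in r -> L (F i)) -> L (\sum_(i <- r) F i).
Proof.
move=> [L0 LD _] LF; rewrite big_seq.
by elim/big_rec: _ => // i x ri Lx; apply: LD => //; apply: LF.
Qed.

Lemma mspan_min U J : is_ideal J -> (forall m, U m -> J 'X_[m]) ->
  mspan U `<=` J.
Proof.
move=> Ji UJ f Uf; rewrite (mpolyE f); apply: ideal_sum_closed => // m mf.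
by rewrite -mul_mpolyC; case: Ji => _ _; apply; apply: UJ; apply: Uf.
Qed.

Definition up_closure (M : set 'X_{1..n}) : set 'X_{1..n} :=
  [set m | exists2 a, M a & exists b, m = (a + b)%MM].

Lemma up_closure_upset M : upset (up_closure M).
Proof.
by move=> _ c [a Ma [b ->]]; exists a => //; exists (b + c)%MM; rewrite addmA.
Qed.

Lemma mon_idealE M : mon_ideal M = mspan (up_closure M) :> set S.
Proof.
apply: ideal_genP; first exact/mspan_ideal/up_closure_upset.
  move=> _ [m Mm <-]; apply/mspanX; exists m => //; exists 0%MM.
  by rewrite addm0.
move=> J Ji MJ; apply: mspan_min => // _ [a Ma [b ->]].
rewrite addmC mpolyXD; case: Ji => _ _; apply; apply: MJ; by exists a.
Qed.

Lemma mspan_inj U V : mspan U = mspan V -> U = V.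
Proof.
by move=> e; apply/seteqP; split=> m /mspanX; [rewrite e|rewrite -e] => /mspanX.
Qed.

(** The generators are the elements of [U] with no proper divisor in [U]. Descent on the degree
    shows that they generate, and each of them must occur in any generating subset. Existence
    ensures that [mingens], a choice with default [set0], meets its specification. *)
Lemma upset_min_gens U : upset U -> exists M, min_mon_gens (mspan U) M.
Proof.
move=> upU.
pose M := [set m | U m /\ forall a b, U a -> m = (a + b)%MM -> b = 0%MM].
have cM : up_closure M = U.
  apply/seteqP; split=> [_ [a [Ua _] [b ->]]|m]; first exact: upU.
  have [d] := ubnP (mdeg m); elim: d m => // d IH m dm Um.
  have [Mm|nMm] := pselect (M m).
    by exists m => //; exists 0%MM; rewrite addm0.
  have [a [b [Ua em b0]]] : exists a b, [/\ U a, m = (a + b)%MM & b <> 0%MM].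
    apply: contrapT => nex; apply: nMm; split=> // a b Ua em.
    by apply: contrapT => b0; apply: nex; exists a, b.
  have [|//|c Mc [e ec]] := IH a.
    move/eqP: b0; rewrite -mdeg_eq0; move: dm; rewrite em mdegD; lia.
  by exists c => //; exists (e + b)%MM; rewrite addmA -ec.
exists M; split; first by rewrite mon_idealE cM.
move=> M' sM' /=; rewrite mon_idealE => /mspan_inj cM'.
apply/seteqP; split=> // m Mm; have [Um mmin] := Mm.
move: (Um); rewrite -cM' => -[a M'a [b em]].
rewrite em (mmin a b) ?addm0 // -cM'; exists a => //.
by exists 0%MM; rewrite addm0.
Qed.

Definition restr (V : pred 'I_n) m : 'X_{1..n} :=
  [multinom (if V i then m i else 0%N) | i < n].

Definition in_supp L : pred 'I_n := fun i => `[< supp L i >].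

(** Some minimal generator divides $m$, and it involves only variables of the support, so it still
    divides $m$ after all other variables are deleted. *)
Lemma upset_restr_supp U m : upset U -> U m -> U (restr (in_supp (mspan U)) m).
Proof.
move=> upU; have := xgetPex set0 (upset_min_gens upU).
rewrite -/(mingens (mspan U)); set M := mingens _ => -[].
rewrite mon_idealE => /mspan_inj cM _; rewrite -{1}cM => -[a Ma [b em]].
rewrite -[X in X (restr _ m)]cM; exists a => //; exists (restr (in_supp (mspan U)) b).
apply/mnmP=> i; rewrite em !(mnmDE, mnmE).
case: (boolP (in_supp _ i)) => // /asboolPn nsi; rewrite addn0.
by apply/esym/eqP; apply: contra_notT nsi => ai; exists a.
Qed.

Definition madd U V : set 'X_{1..n} := [set (a + b)%MM | a in U & b in V].

(** Exponents of the monomials in the $k$-th power. The iteration starts from [setT], as in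
    [ideal_pow], so the power $0$ is the unit ideal. *)
Definition mpow U k := iter k (madd U) setT.

Lemma madd_upset U V : upset V -> upset (madd U V).
Proof.
move=> upV _ c [a Ua [b Vb <-]]; exists a => //.
by exists (b + c)%MM; [exact: upV|rewrite addmA].
Qed.

Lemma mpow_upset U k : upset (mpow U k).
Proof. by case: k => // k; apply: madd_upset; elim: k => // k; apply: madd_upset. Qed.

Lemma ideal_mul_mspan U V : upset V -> ideal_mul (mspan U) (mspan V) = mspan (madd U V).
Proof.
move=> upV; apply: ideal_genP; first exact/mspan_ideal/madd_upset.
  move=> _ [f Uf [g Vg <-]] m /msuppM_le /allpairsP[[a b] /= [fa gb ->]].
  by exists a; [exact: Uf|exists b => //; exact: Vg].
move=> J Ji UVJ; apply: mspan_min => // _ [a Ua [b Vb <-]].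
rewrite mpolyXD; apply: UVJ; exists 'X_[a]; first exact/mspanX.
by exists 'X_[b] => //; exact/mspanX.
Qed.

Lemma ideal_pow_mspan U k : ideal_pow (mspan U) k = mspan (mpow U k).
Proof.
elim: k => [|k IH]; first by apply/seteqP.
by rewrite /ideal_pow iterS -/(ideal_pow _ k) IH ideal_mul_mspan //; exact: mpow_upset.
Qed.

Lemma ideal_sum_mspan t (U : 'I_t -> set 'X_{1..n}) :
  (0 < t)%N -> (forall j, upset (U j)) ->
  ideal_sum (fun j => mspan (U j)) = mspan [set m | exists j, U j m].
Proof.
move=> t0 upU; apply/seteqP; split=> [_ [f Uf <-] m /msupp_sum_le|f Uf].
  by move=> /flattenP[s /mapP[j _ ->]] mf; exists j; exact: Uf.
(* Each term of $f$ is assigned to one summand containing it, and the terms are grouped accordingly.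
   The default index serves monomials in no [U j], which do not occur in $f$. *)
pose c m : 'I_t :=
  if pselect (exists j, U j m) is left e then projT1 (cid e) else Ordinal t0.
have cP m : m \in msupp f -> U (c m) m.
  by move=> /Uf e; rewrite /c; case: pselect => // e'; case: (cid e').
exists (fun j => \sum_(m <- msupp f | c m == j) f@_m *: 'X_[m]).
  move=> j; rewrite -big_filter; apply: ideal_sum_closed; first exact: mspan_ideal.
  move=> m; rewrite mem_filter => /andP[/eqP <- mf].
  by case: (mspan_ideal (upU (c m))) => _ _ UZ; rewrite -mul_mpolyC; apply/UZ/mspanX/cP.
rewrite [RHS](mpolyE f) [RHS](partition_big c xpredT) //=.
Qed.

Lemma monomial_idealP L : monomial_ideal L -> exists2 U, upset U & L = mspan U.
Proof.
by case=> M ->; exists (up_closure M); [exact: up_closure_upset|exact: mon_idealE].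
Qed.

End MonomialSpans.

(** * Prime colon ideals of monomial ideals *)

Section MonomialPrimes.
Variables (K : fieldType) (n : nat).
Local Notation S := {mpoly K[n]}.
Implicit Types (L p : set S) (f g h : S) (m u : 'X_{1..n}).
Implicit Types (U : set 'X_{1..n}).

Lemma prime_idealP p : is_prime_ideal p <->
  [/\ is_ideal p, ~ p 1 & forall f g, p (f * g) -> p f \/ p g].
Proof.
have inE' (f : S) : (f \in (fun f => f \in p)) = `[<p f>].
  by rewrite [LHS]/(f \in p); apply/idP/asboolP => [/set_mem|/mem_set].
split=> [[[p0 p1 pZ] pP]|[[p0 pD pM] p1 pP]].
  move: p0 p1; rewrite !inE' => /asboolP p0 /asboolPn p1.
  have pM a f : p f -> p (a * f).
    move=> pf; apply/asboolP; rewrite -inE' -[a * f]addr0.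
    by apply: pZ; rewrite inE'; exact/asboolP.
  split=> //; first split=> // f g pf pg.
    apply/asboolP; rewrite -inE' -[f]mul1r.
    by apply: pZ; rewrite inE'; exact/asboolP.
  move=> f g pfg; have := pP f g; rewrite !inE' => /(_ (asboolT pfg)).
  by case/orP=> /asboolP; [left|right].
split.
  split; rewrite ?inE'; [exact/asboolP|exact/asboolPn|].
  move=> a f g; rewrite !inE' => /asboolP pf /asboolP pg.
  by apply/asboolP/pD => //; exact: pM.
move=> f g; rewrite !inE' => /asboolP /pP[] /asboolP -> //.
by rewrite orbT.
Qed.

Lemma prime_monomial p m : is_prime_ideal p -> p 'X_[m] ->
  exists2 i, m i != 0%N & p 'X_i.
Proof.
move=> /prime_idealP[_ p1 pM]; rewrite mpolyXE_id.
elim/big_rec: _ => [/p1 //|i x _ IH] /pM[|/IH //].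
move=> pX; case mi: (m i) pX => [|k] pX; first by move: pX; rewrite expr0 => /p1.
exists i; first by rewrite mi.
elim: k.+1 pX => [|j IHj]; first by rewrite expr0 => /p1.
by rewrite exprS => /pM[//|/IHj].
Qed.

Lemma prime_prod p (r : seq 'X_{1..n}) (h : 'X_{1..n} -> S) : is_prime_ideal p ->
  (forall u, u \in r -> ~ p (h u)) -> ~ p (\prod_(u <- r) h u).
Proof.
move=> /prime_idealP[_ p1 pM]; elim: r => [|u r IH] ph; first by rewrite big_nil.
rewrite big_cons => /pM[|]; first by apply: ph; rewrite mem_head.
by apply: IH => v vr; apply: ph; rewrite inE vr orbT.
Qed.

(** Multiplication by a monomial shifts the exponents injectively, so no terms cancel. *)
Lemma mspan_mulX U g u : mspan U (g * 'X_[u]) <-> forall m, m \in msupp g -> U (m + u)%MM.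
Proof.
split=> [H m mg|H m].
  by apply: H; rewrite mcoeff_msupp addmC mcoeffMX -mcoeff_msupp.
by move=> /msuppM_le /allpairsP[[a b] /= [/H Hab]]; rewrite msuppX mem_seq1 => /eqP -> ->.
Qed.

Definition tail f : S := f - f@_(mlead f) *: 'X_[mlead f].

Lemma tail_size f : f != 0 -> (size (msupp (tail f)) < size (msupp f))%N.
Proof.
move=> f0; have lf := mlead_supp f0.
by rewrite (perm_size (msupp_rem f (mlead f))) size_rem // prednK //; case: (msupp f) lf.
Qed.

(* If X^lead(g) is not in the prime p = (L : f), then (L : X^lead(g) f) = p as well,
   and modulo L the leading term of X^lead(g) f drops, so f can be replaced by
   a polynomial with fewer terms. *)
Lemma prime_colon_mlead U f g : upset U -> is_prime_ideal (colon (mspan U) f) ->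
  colon (mspan U) f g -> g != 0 -> colon (mspan U) f 'X_[mlead g].
Proof.
move=> upU; have [L0 LD LM] := mspan_ideal K upU.
have [d] := ubnP (size (msupp f)); elim: d f => // d IH f fd pp gp g0.
have /prime_idealP[_ p1 pM] := pp.
have f0 : f != 0.
  by apply: contra_notN p1 => /eqP ->; rewrite /colon /= mulr0.
apply: contrapT => ngp; pose f' := 'X_[mlead g] * tail f.
have Ulead : U (mlead g + mlead f)%MM.
  by rewrite -mleadM //; apply: gp; rewrite mlead_supp // mulf_neq0.
have ef' : colon (mspan U) f' = colon (mspan U) f.
  have eh h : h * f' =
      h * 'X_[mlead g] * f - h * (f@_(mlead f))%:MP * 'X_[mlead g + mlead f].
    rewrite /f' /tail -mul_mpolyC mpolyXD; ring.
  have LX h : mspan U (h * 'X_[mlead g + mlead f]) by apply: LM; exact/mspanX.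
  apply/seteqP; split=> h; rewrite /colon /= eh => Lh.
    have : colon (mspan U) f (h * 'X_[mlead g]).
      rewrite /colon /=.
      rewrite -[X in mspan U X](subrK (h * (f@_(mlead f))%:MP * 'X_[mlead g + mlead f])).
      exact: LD.
    by case/pM.
  rewrite -mulNr; apply: LD; first by rewrite mulrAC mulrC; exact: LM.
  by rewrite -mulNr; exact: LX.
rewrite -ef' in pp gp ngp; apply: ngp; apply: IH => //.
apply: leq_trans (_ : size (msupp (tail f)) < d)%N; last first.
  by rewrite (leq_trans (tail_size f0)).
by rewrite ltnS /f' mulrC (perm_size (msuppMX _ _)) size_map.
Qed.

(** Leading terms are peeled off $g$ one at a time: each lies in the colon, so the tail does too,
    and the number of terms drops. Thus a prime colon ideal of a monomial ideal is itself
    monomial. *)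
Lemma prime_colon_monomial U f g m : upset U -> is_prime_ideal (colon (mspan U) f) ->
  colon (mspan U) f g -> m \in msupp g -> colon (mspan U) f 'X_[m].
Proof.
move=> upU pp; have /prime_idealP[[p0 pD pM] _ _] := pp.
have [d] := ubnP (size (msupp g)); elim: d g => // d IH g gd gp mg.
have g0 : g != 0 by apply: contraTneq mg => ->; rewrite msupp0.
have lp := prime_colon_mlead upU pp gp g0.
have [->//|ne] := eqVneq m (mlead g).
apply: (IH (tail g)); first by rewrite (leq_trans (tail_size g0)).
  apply: pD => //; rewrite -mul_mpolyC -mulNr; exact: pM.
by rewrite (perm_mem (msupp_rem g (mlead g))) mem_rem_uniq // inE ne.
Qed.

(** Since $(L:f)$ is monomial, it is contained in $(L:X^u)$ for every term $X^u$ of $f$. If all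
    these inclusions were strict, the product of elements $h_u$ of the differences would send every
    term of $f$ into $L$, hence lie in $(L:f)$, against primality. *)
Lemma prime_colon_term U f : upset U -> is_prime_ideal (colon (mspan U) f) ->
  exists2 u, u \in msupp f & colon (mspan U) 'X_[u] = colon (mspan U) f.
Proof.
move=> upU pp; have [L0 LD LM] := mspan_ideal K upU.
apply: contrapT => nex.
have sub u : u \in msupp f -> colon (mspan U) f `<=` colon (mspan U) 'X_[u].
  move=> uf g gp; apply/mspan_mulX => m mg.
  have := prime_colon_monomial upU pp gp mg; rewrite /colon /= mulrC => Lmf.
  by apply: Lmf; rewrite mcoeff_msupp mcoeffMX -mcoeff_msupp.
have hP u : exists h, u \in msupp f -> colon (mspan U) 'X_[u] h /\ ~ colon (mspan U) f h.
  have [uf|nuf] := boolP (u \in msupp f); last by exists 0.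
  apply: contrapT => nh; apply: nex; exists u => //.
  apply/seteqP; split; last exact: sub.
  by move=> h hu; apply: contrapT => nhp; apply: nh; exists h.
have [h {}hP] := choice hP.
apply: (@prime_prod _ (msupp f) h pp) => [u /hP[]//|].
rewrite /colon /= [in X in _ * X](mpolyE f) mulr_sumr.
apply: ideal_sum_closed => // u uf.
have [hu _] := hP u uf.
rewrite (perm_big _ (perm_to_rem uf)) big_cons /= -mul_mpolyC.
rewrite [X in mspan U X](_ : _ =
  (\prod_(j <- rem u (msupp f)) h j) * (f@_u)%:MP * (h u * 'X_[u])).
  exact: LM.
ring.
Qed.

End MonomialPrimes.

(** * The v-number computed with monomials *)

Section VNumber.
Variables (K : fieldType) (n : nat).
Local Notation S := {mpoly K[n]}.
Implicit Types (f g h : S) (m u : 'X_{1..n}) (U : set 'X_{1..n}).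

(* The ideal generated by the variables in V is the kernel of the substitution
   that sends these variables to 0, hence prime. *)
Lemma variable_ideal_prime (V : pred 'I_n) :
  is_prime_ideal (mspan [set m | exists2 i, V i & m i != 0%N] : set S).
Proof.
pose phi : S -> S := mmap (@mpolyC n K) (fun i => if V i then 0 else 'X_i).
have phiX m : phi 'X_[m] = if [exists i, V i && (m i != 0%N)] then 0 else 'X_[m].
  rewrite /phi mmapX /mmap1; case: ifPn => [/existsP[i /andP[Vi mi]]|].
    by rewrite (bigD1 i) //= Vi expr0n (negPf mi) mul0r.
  rewrite negb_exists => /forallP noV; rewrite [RHS]mpolyXE_id.
  apply: eq_bigr => i _; case: ifPn => // Vi.
  by have := noV i; rewrite Vi negbK => /eqP ->; rewrite !expr0.
have phi_sum f : phi f = \sum_(k <- msupp f) f@_k *: phi 'X_[k].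
  by rewrite /phi {1}/mmap; apply: eq_bigr => k _; rewrite mmapX mul_mpolyC.
have phiE f m : ~ (exists2 i, V i & m i != 0%N) -> (phi f)@_m = f@_m.
  move=> noV; transitivity ((\sum_(k <- msupp f) f@_k *: 'X_[k])@_m);
    last by rewrite -mpolyE.
  rewrite phi_sum !raddf_sum /=; apply: eq_bigr => k _; rewrite phiX.
  case: ifPn => // /existsP[i /andP[Vi ki]].
  rewrite scaler0 mcoeff0 mcoeffZ mcoeffX; case: eqVneq => [km|]; last by rewrite mulr0.
  by case: noV; exists i; rewrite -?km.
have kerP f : mspan [set m | exists2 i, V i & m i != 0%N] f <-> phi f = 0.
  split=> [Vf|f0 m mf].
    rewrite phi_sum big_seq big1 // => m /Vf /= [i Vi mi].
    rewrite phiX ifT ?scaler0 //.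
    by apply/existsP; exists i; rewrite Vi.
  apply: contrapT => /= /(phiE f); rewrite f0 mcoeff0 => /esym/eqP.
  by apply/negP; rewrite -mcoeff_msupp.
apply/prime_idealP; split.
- apply: mspan_ideal => m1 m2 /= [i Vi mi]; exists i => //.
  by rewrite mnmDE addn_eq0 negb_and mi.
- by move/kerP/eqP; rewrite /phi rmorph1 oner_eq0.
- move=> f g /kerP; rewrite /phi rmorphM => /eqP; rewrite mulf_eq0.
  by case/orP=> /eqP /kerP; [left|right].
Qed.

(** Exponent form of the statement that $(L:X^u)$ is proper and generated by variables. *)
Definition killed_by_variables U u :=
  ~ U u /\ forall m, U (m + u)%MM -> exists2 i, U (U_(i) + u)%MM & m i != 0%N.

Lemma killed_prime U u : upset U -> killed_by_variables U u ->
  is_prime_ideal (colon (mspan U) 'X_[u] : set S).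
Proof.
move=> upU [nUu kU].
have -> : colon (mspan U) 'X_[u] =
    mspan [set m | exists2 i, `[<U (U_(i) + u)%MM>] & m i != 0%N] :> set S.
  apply/seteqP; split=> f; rewrite /colon /=.
    by move/mspan_mulX=> Uf m /Uf /kU [i /asboolP Vi mi]; exists i.
  move=> Vf; apply/mspan_mulX => m /Vf /= [i /asboolP Vi mi].
  have -> : (m + u = (U_(i) + u) + (m - U_(i)))%MM.
    by rewrite -addmA [(u + _)%MM]addmC addmA [(U_(i) + _)%MM]addmC submK // lep1mP.
  exact: upU.
exact: variable_ideal_prime.
Qed.

(** Among the monomials outside the ideal, take $u$ for which the number of variables $x_i$ with
    $x_i u$ in the ideal is maximal. This gives an associated prime of every proper monomial
    ideal. *)
Lemma killed_exists U : upset U -> ~ U 0%MM -> exists u, killed_by_variables U u.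
Proof.
move=> upU nU0; pose V u := [pred i | `[<U (U_(i) + u)%MM>]].
pose P k := `[<exists2 u, ~ U u & #|V u| = k>].
have exP : exists k, P k by exists #|V 0%MM|; apply/asboolP; exists 0%MM.
have ubP k : P k -> (k <= n)%N.
  by move=> /asboolP[u _ <-]; rewrite -[X in (_ <= X)%N]card_ord max_card.
case: (ex_maxnP exP ubP) => k /asboolP[u nUu <-] kmax; exists u; split=> // m.
have [d] := ubnP (mdeg m); elim: d m => // d IH m md Um.
have [m0|] := eqVneq m 0%MM; first by case: nUu; rewrite -[u]add0m -m0.
rewrite -mdeg_eq0 mdegE sum_nat_eq0 negb_forall => /existsP[i /= mi].
have em : m = (U_(i) + (m - U_(i)))%MM by rewrite addmC submK // lep1mP.
have [Um'|nUm'] := pselect (U ((m - U_(i)) + u)%MM).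
  have [|j Vj mj] := IH (m - U_(i))%MM _ Um'.
    by move: md; rewrite {1}em mdegD mdeg1.
  exists j => //; apply: contra mj => /eqP mj.
  by rewrite mnmBE mj.
(* Otherwise $(m/x_i)u$ is outside the ideal and is sent into it by every variable that does so for
   $u$, and also by the new variable $x_i$, contradicting maximality. *)
have [Vi|nVi] := pselect (U (U_(i) + u)%MM); first by exists i.
suff : (#|V u| < #|V ((m - U_(i)) + u)%MM|)%N.
  by rewrite ltnNge kmax //; apply/asboolP; exists ((m - U_(i)) + u)%MM.
apply/proper_card/properP; split.
  apply/fintype.subsetP => j /asboolP Vj; apply/asboolP.
  by rewrite [((m - _) + _)%MM]addmC addmA; exact: upU.
exists i; first by apply/asboolP; rewrite addmA -em.
by apply/asboolP.
Qed.

Lemma v_number_le U u : is_prime_ideal (colon (mspan U) 'X_[u] : set S) ->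
  (v_number (mspan U : set S) <= mdeg u)%N.
Proof.
move=> pp; apply: leq_trans (_ : v_at (mspan U) (colon (mspan U) ('X_[u] : S)) <= _)%N.
  by apply: least_le; exists (colon (mspan U) 'X_[u]) => //; split=> //; exists 'X_[u].
by apply: least_le; exists 'X_[u] => //; rewrite dhomogX.
Qed.

(** Both uses of [least] range over nonempty sets, so their values are attained by a homogeneous
    $g$. A term of $g$ with the same colon ideal has the same degree by homogeneity. *)
Lemma v_number_attained U : upset U -> ~ U 0%MM ->
  exists2 u, is_prime_ideal (colon (mspan U) 'X_[u] : set S) &
    mdeg u = v_number (mspan U : set S).
Proof.
move=> upU nU0; have [w /(killed_prime upU) wp] := killed_exists upU nU0.
have [p [pp [f ef]] <-] :
    [set v_at (mspan U : set S) p | p in Ass (mspan U)] (v_number (mspan U : set S)).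
  apply: least_mem; exists (v_at (mspan U) (colon (mspan U) ('X_[w] : S))).
  by exists (colon (mspan U) 'X_[w]) => //; split=> //; exists 'X_[w].
have [g gh eg] :
    [set d | exists2 f : S, f \is d.-homog & colon (mspan U) f = p] (v_at (mspan U) p).
  apply: least_mem; rewrite ef in pp *.
  have [u uf eu] := prime_colon_term upU pp.
  by exists (mdeg u), 'X_[u] => //; rewrite dhomogX.
rewrite -eg in pp; have [u ug eu] := prime_colon_term upU pp.
by exists u; [rewrite eu|by move/dhomogP: gh => /(_ _ ug)].
Qed.

End VNumber.

(** * The order of a monomial with respect to powers *)

Section PowerOrder.
Variable n : nat.
Implicit Types (m u : 'X_{1..n}) (U : set 'X_{1..n}) (V : pred 'I_n).

Lemma mpow_anti U j k m : (j <= k)%N -> mpow U k m -> mpow U j m.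
Proof.
move=> /subnK <-; elim: (k - j)%N m => [//|d IH] m; rewrite addSn => -[a _ [b Ub <-]].
by apply: IH; rewrite addmC; exact: mpow_upset.
Qed.

Lemma mpowS_add U k m1 m2 : U m1 -> mpow U k m2 -> mpow U k.+1 (m1 + m2)%MM.
Proof. by move=> U1 U2; exists m1 => //; exists m2. Qed.

Lemma mpow_add U k l m1 m2 : mpow U k m1 -> mpow U l m2 -> mpow U (k + l) (m1 + m2)%MM.
Proof.
elim: k m1 => [|k IH] m1 U1 U2; first by rewrite addmC; exact: mpow_upset.
by case: U1 => a Ua [b Ub <-]; rewrite -addmA; apply: mpowS_add => //; exact: IH.
Qed.

Lemma mpow_mulmn U k m : U m -> mpow U k (m *+ k)%MM.
Proof. by move=> Um; elim: k => // k IH; rewrite mulmS; exact: mpowS_add. Qed.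

Lemma mpow_sub U U' k : U `<=` U' -> mpow U k `<=` mpow U' k.
Proof.
move=> UU'; elim: k => // k IH _ [a Ua [b Ub <-]].
by apply: mpowS_add; [exact: UU'|exact: IH].
Qed.

Lemma mpow_mdeg U d k m : (forall m, U m -> (d <= mdeg m)%N) -> mpow U k m ->
  (d * k <= mdeg m)%N.
Proof.
move=> Ud; elim: k m => [|k IH] m; first by rewrite muln0.
by move=> [a /Ud da [b /IH db <-]]; rewrite mulnS mdegD leq_add.
Qed.

(** Write $x_i u = ab$ with $a$ in [U] and $b$ in the power one lower. If $x_i$ divides $a$, then
    $u$ is a multiple of $b$. Otherwise $x_i$ divides $b$, and induction applies to $b/x_i$. *)
Lemma mpow_divX U k i u : upset U -> mpow U k.+1 (U_(i) + u)%MM -> mpow U k u.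
Proof.
move=> upU; elim: k u => // k IH u [a Ua [b Ub eu]].
have eu' x : (a x + b x = (i == x) + u x)%N.
  by have /mnmP/(_ x) := eu; rewrite !mnmDE mnm1E.
have [ai|ai] := eqVneq (a i) 0%N; last first.
  have -> : u = (b + (a - U_(i)))%MM; last exact: mpow_upset.
  apply/mnmP => x; rewrite mnmDE mnmBE mnm1E; move: (eu' x).
  by case: (eqVneq i x) ai => [<-|_] /=; lia.
have bi : b i != 0%N by have := eu' i; rewrite eqxx ai; lia.
have -> : u = (a + (b - U_(i)))%MM.
  apply/mnmP => x; rewrite mnmDE mnmBE mnm1E; move: (eu' x).
  by case: (eqVneq i x) bi => [<-|_] /=; lia.
by apply: mpowS_add => //; apply: IH; rewrite addmC submK // lep1mP.
Qed.

Lemma restrD V m1 m2 : restr V (m1 + m2) = (restr V m1 + restr V m2)%MM.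
Proof. by apply/mnmP => i; rewrite !(mnmDE, mnmE); case: ifP. Qed.

Lemma restr_sum (T : finType) (W : T -> pred 'I_n) (u : T -> 'X_{1..n}) j :
  (forall i j x, W i x -> W j x -> i = j) ->
  restr (W j) (\sum_l restr (W l) (u l))%MM = restr (W j) (u j).
Proof.
move=> dW; apply/mnmP => x; rewrite !mnmE mnm_sumE; case: ifP => // Wjx.
rewrite (bigD1 j) //= !mnmE Wjx big1 ?addn0 // => l lj; rewrite mnmE.
by case: ifP => // /dW /(_ Wjx) e; rewrite e eqxx in lj.
Qed.

Lemma sum_restr_le (T : finType) (W : T -> pred 'I_n) m :
  (forall i j x, W i x -> W j x -> i = j) -> (\sum_j restr (W j) m <= m)%MM.
Proof.
move=> dW; apply/mnm_lepP => x; rewrite mnm_sumE.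
have [j Wjx|noW] := pickP (fun j => W j x); last first.
  by rewrite big1 // => j _; rewrite mnmE noW.
rewrite (bigD1 j) //= mnmE Wjx big1 ?addn0 // => l lj; rewrite mnmE.
by case: ifP => // /dW /(_ Wjx) e; rewrite e eqxx in lj.
Qed.

Lemma mdeg_restr V m : (mdeg (restr V m) <= mdeg m)%N.
Proof.
have -> : restr V m = (m - restr (predC V) m)%MM; last exact: mdegB.
by apply/mnmP => i; rewrite !(mnmBE, mnmE) /=; case: (V i) => /=; rewrite ?subn0 ?subnn.
Qed.

Lemma mpow_restr U V k m : (forall m, U m -> U (restr V m)) -> mpow U k m ->
  mpow U k (restr V m).
Proof.
move=> UV; elim: k m => // k IH _ [a Ua [b Ub <-]].
by rewrite restrD; apply: mpowS_add; [exact: UV|exact: IH].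
Qed.

(** The search may stop at the degree of $m$: when [U] omits $0$, every element of it has positive
    degree, so $m$ lies in no power beyond its degree. *)
Definition mord U m := \max_(k < (mdeg m).+1 | `[<mpow U k m>]) k.

Lemma mordP U k m : ~ U 0%MM -> mpow U k m <-> (k <= mord U m)%N.
Proof.
move=> nU0; have U1 m' : U m' -> (1 <= mdeg m')%N.
  by rewrite lt0n mdeg_eq0; apply: contraPneq => ->.
split=> [Uk|]; last first.
  move=> /mpow_anti; apply; rewrite /mord.
  by elim/big_ind: _ => // [x y Ux Uy|i /asboolP //]; rewrite /maxn; case: ifP.
have km : (k < (mdeg m).+1)%N by have := mpow_mdeg U1 Uk; rewrite mul1n ltnS.
by apply: (@leq_bigmax_cond _ _ (fun k : 'I__ => k : nat) (Ordinal km)); exact/asboolP.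
Qed.

Lemma mord0 U : mord U 0%MM = 0%N.
Proof. by rewrite /mord mdeg0; apply: big1 => i _; rewrite ord1. Qed.

Lemma mord_mono U m1 m2 : ~ U 0%MM -> (mord U m1 <= mord U (m1 + m2))%N.
Proof. by move=> nU0; apply/(mordP _ _ nU0)/mpow_upset/(mordP _ _ nU0). Qed.

Lemma mord_restr U V m : ~ U 0%MM -> (forall m, U m -> U (restr V m)) ->
  mord U (restr V m) = mord U m.
Proof.
move=> nU0 UV; apply/eqP; rewrite eqn_leq; apply/andP; split; last first.
  by apply/(mordP _ _ nU0)/mpow_restr => //; exact/(mordP _ _ nU0).
have {2}-> : m = (restr V m + restr (predC V) m)%MM; last exact: mord_mono.
by apply/mnmP => i; rewrite !(mnmDE, mnmE) /=; case: (V i); rewrite ?addn0.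
Qed.

Lemma mordU_le U i u : ~ U 0%MM -> upset U -> (mord U (U_(i) + u) <= (mord U u).+1)%N.
Proof.
move=> nU0 upU; case e : (mord U (U_(i) + u)) => [//|k]; rewrite ltnS.
by apply/(mordP _ _ nU0)/(@mpow_divX _ _ i) => //; apply/(mordP _ _ nU0); rewrite e.
Qed.

(** A factor from [U i] raises the $i$-th order by at least one and lowers no other, which gives one
    direction. For the other, $m$ is a multiple of the product of its parts on the disjoint [V j],
    and each part keeps its order. *)
Lemma mpow_union (t : nat) (U : 'I_t -> set 'X_{1..n}) (V : 'I_t -> pred 'I_n) k m :
  (forall j, ~ U j 0%MM) -> (forall j m, U j m -> U j (restr (V j) m)) ->
  (forall i j x, V i x -> V j x -> i = j) ->
  mpow [set m | exists j, U j m] k m <-> (k <= \sum_j mord (U j) m)%N.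
Proof.
move=> nU0 UV dV; split.
  elim: k m => // k IH _ [a [i Ua] [b /IH Wb <-]].
  apply: leq_trans (_ : (\sum_j mord (U j) b).+1 <= _)%N; first by rewrite ltnS.
  rewrite (bigD1 i) //= [X in (_ <= X)%N](bigD1 i) //= -addSn leq_add //.
    by apply/(mordP _ _ (nU0 i))/mpowS_add => //; exact/(mordP _ _ (nU0 i)).
  by apply: leq_sum => j _; rewrite addmC; apply: mord_mono.
move=> /mpow_anti; apply.
rewrite -[X in mpow _ _ X](submK (sum_restr_le m dV)) addmC; apply: mpow_upset.
apply: (big_ind2 (fun l m => mpow _ l m)) => //.
  by move=> k1 m1 k2 m2; exact: mpow_add.
move=> j _; apply: (@mpow_sub (U j)) => [w Uw|]; first by exists j.
apply: mpow_restr; first exact: UV.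
by apply/mordP.
Qed.

End PowerOrder.

(** * Lower and upper bounds for powers of the sum *)

Section SumOfMonomialIdeals.
Variables (K : fieldType) (n t : nat).
Variables (U : 'I_t -> set 'X_{1..n}) (V : 'I_t -> pred 'I_n).
Hypothesis upU : forall j, upset (U j).
Hypothesis nU0 : forall j, ~ U j 0%MM.
Hypothesis UV : forall j m, U j m -> U j (restr (V j) m).
Hypothesis dV : forall i j x, V i x -> V j x -> i = j.
Local Notation W := [set m | exists j, U j m].
Local Notation S := {mpoly K[n]}.

(** The $k$-th power of a generator restricted to [V j] lies in the colon ideal, so primality yields
    one of the variables dividing it. *)
Lemma colon_mpow_var j k c u : (0 < k)%N -> U j c ->
  is_prime_ideal (colon (mspan (mpow W k)) 'X_[u] : set S) ->
  exists2 i, V j i & mpow W k (U_(i) + u)%MM.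
Proof.
move=> k0 Uc pp; pose c' := (restr (V j) c *+ k)%MM.
have : (colon (mspan (mpow W k)) 'X_[u] : set S) 'X_[c'].
  rewrite /colon /= -mpolyXD; apply/mspanX/mpow_upset/mpow_mulmn.
  by exists j; exact: UV.
move=> /(prime_monomial pp) [i ci]; rewrite /colon /= -mpolyXD => /mspanX Wi.
by exists i => //; move: ci; rewrite mulmnE mnmE; case: ifP.
Qed.

Lemma colon_mpow_lower (alpha : 'I_t -> nat) k u : (0 < t)%N -> (0 < k)%N ->
  (forall j, exists m, U j m) -> (forall j m, U j m -> (alpha j <= mdeg m)%N) ->
  is_prime_ideal (colon (mspan (mpow W k)) 'X_[u] : set S) ->
  exists o : 'I_t -> nat, (\sum_j o j).+1 = k /\
    (\sum_j alpha j * (o j).+1 <= mdeg u + t)%N.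
Proof.
move=> t0 k0 Une Ualpha pp; exists (fun j => mord (U j) u).
have WE k' m := mpow_union k' m nU0 UV dV.
have nWu : (\sum_j mord (U j) u < k)%N.
  rewrite ltnNge; apply/negP => /WE Wu.
  by have /prime_idealP[_ + _] := pp; apply; rewrite /colon /= mul1r; exact/mspanX.
(* Multiplying $u$ by $x_i$ lifts the total order from below $k$ to at least $k$. By disjointness
   only the $j$-th order can change, and it grows by at most one, so it grows by exactly one. *)
have step j : exists2 i, V j i & mord (U j) (U_(i) + u) = (mord (U j) u).+1 /\
    (k <= (\sum_l mord (U l) u).+1)%N.
  have [c Uc] := Une j; have [i Vi /WE kW] := colon_mpow_var k0 Uc pp.
  have off l : l != j -> mord (U l) (U_(i) + u) = mord (U l) u.
    move=> lj; rewrite -(mord_restr _ (@nU0 l) (@UV l)).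
    rewrite -[RHS](mord_restr _ (@nU0 l) (@UV l)).
    rewrite restrD (_ : restr (V l) U_(i) = 0%MM) ?add0m //.
    apply/mnmP => x; rewrite mnmE mnm1E mnm0E; case: ifP => // Vx.
    by case: eqVneq => // ix; rewrite (dV Vx (_ : V j x)) -?ix // eqxx in lj.
  have e : (\sum_l mord (U l) (U_(i) + u) + mord (U j) u =
            \sum_l mord (U l) u + mord (U j) (U_(i) + u))%N.
    by rewrite (bigD1 j) //= [in RHS](bigD1 j) //= (eq_bigr _ off) addnC addnA addnAC.
  by have := mordU_le i u (@nU0 j) (@upU j); exists i => //; lia.
split; first by have [_ _ [_]] := step (Ordinal t0); lia.
(* The part of $x_i u$ on [V j] lies in the power $o_j+1$ of [U j] and has degree at most one more
   than that of $u$. The $t$ extra units give the summand [t]. *)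
apply: leq_trans (_ : (\sum_j (mdeg (restr (V j) u) + 1) <= _)%N).
  apply: leq_sum => j _; have [i Vi [oi _]] := step j.
  rewrite -{}oi; apply: leq_trans (_ : mdeg (restr (V j) (U_(i) + u)) <= _)%N.
    apply: (mpow_mdeg (@Ualpha j)); apply: mpow_restr; first exact: UV.
    exact/mordP.
  by rewrite restrD mdegD addnC leq_add2l -(mdeg1 i) mdeg_restr.
rewrite big_split /= sum1_card card_ord leq_add2r -mdeg_sum.
rewrite -[X in (_ <= mdeg X)%N](submK (sum_restr_le u dV)) mdegD; exact: leq_addl.
Qed.

(** Let $f$ be the product of the restricted $u_j$. Its orders are $c_j-1$, so by pigeonhole $mf$
    lies in the power $1+\sum_j(c_j-1)$ only if some $j$-th order reaches $c_j$, that is, only if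
    $m$ lies in the $j$-th given prime. Some variable dividing $m$ is then in that prime as well. *)
Lemma v_number_sum_le (c : 'I_t -> nat) (u : 'I_t -> 'X_{1..n}) :
  (forall j, (0 < c j)%N) -> (forall j, exists m, U j m) ->
  (forall j, is_prime_ideal (colon (mspan (mpow (U j) (c j))) 'X_[u j] : set S)) ->
  (v_number (mspan (mpow W (\sum_j (c j).-1).+1) : set S) <= \sum_j mdeg (u j))%N.
Proof.
move=> c0 Une up; pose f := (\sum_j restr (V j) (u j))%MM.
have WE k' m := mpow_union k' m nU0 UV dV.
have ordf m j : mord (U j) (m + f) = mord (U j) (m + u j).
  rewrite -[LHS](mord_restr _ (@nU0 j) (@UV j)) -[RHS](mord_restr _ (@nU0 j) (@UV j)).
  by rewrite !restrD /f restr_sum.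
have inp j m : (colon (mspan (mpow (U j) (c j))) 'X_[u j] : set S) 'X_[m] <->
    (c j <= mord (U j) (m + f))%N.
  rewrite ordf -mordP // /colon /= -mpolyXD; exact: mspanX.
(* The order is below $c_j$ because the prime omits $1$. It is at least $c_j-1$ because some
   variable in the prime raises it to $c_j$ or more, by a single unit at most. *)
have ordfj j : mord (U j) f = (c j).-1.
  apply/eqP; rewrite eqn_leq; apply/andP; split.
    rewrite -ltnS prednK // ltnNge; apply/negP; rewrite -[f]add0m => /inp.
    by rewrite mpolyX0; have /prime_idealP[] := up j.
  have [w Uw] := Une j.
  have /(prime_monomial (up j))[i _ /inp] :
      (colon (mspan (mpow (U j) (c j))) 'X_[u j] : set S) 'X_[w *+ c j].
    by rewrite /colon /= -mpolyXD; apply/mspanX/mpow_upset/mpow_mulmn.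
  by have := mordU_le i f (@nU0 j) (@upU j); lia.
have ordSf m j : (c j <= mord (U j) (m + f))%N ->
    mpow W (\sum_j (c j).-1).+1 (m + f)%MM.
  move=> cj; apply/WE; rewrite (bigD1 j) //= [X in (_ <= X)%N](bigD1 j) //= -addSn.
  rewrite prednK // leq_add // leq_sum // => l _.
  by rewrite -ordfj addmC; exact: mord_mono.
apply: leq_trans (_ : mdeg f <= _)%N; last first.
  by rewrite mdeg_sum leq_sum // => j _; exact: mdeg_restr.
apply: v_number_le; apply: killed_prime; first exact: mpow_upset.
split=> [/WE|m /WE]; first by rewrite (eq_bigr _ (fun j _ => ordfj j)) ltnn.
move=> lt; have [j cj] : exists j, (c j <= mord (U j) (m + f))%N.
  apply: contrapT => nex; move: lt; rewrite ltnNge leq_sum // => j _.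
  by rewrite -ltnS prednK // ltnNge; apply/negP => cj; apply: nex; exists j.
have [i mi /inp ci] := prime_monomial (up j) ((inp j m).2 cj).
by exists i => //; exact: ordSf ci.
Qed.

End SumOfMonomialIdeals.

(** * The stability index and an explicit upper bound *)

Lemma v_stab1_linear (K : fieldType) (n : nat) (L : set {mpoly K[n]})
    (a : int) (k0 : nat) :
  (forall k : nat, (k0 <= k)%N -> (v_number (ideal_pow L k))%:Z = a * k%:Z - 1) ->
  v_stab L = 1%N ->
  forall k : nat, (1 <= k)%N -> (v_number (ideal_pow L k))%:Z = a * k%:Z - 1.
Proof.
move=> vL stab; pose P := [set k0 : nat | (1 <= k0)%N /\ exists a b : int,
  forall k : nat, (k0 <= k)%N -> (v_number (ideal_pow L k))%:Z = a * k%:Z + b].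
have : P (least P).
  (* The successor provides the lower bound $1$ required of a stability index. *)
  apply: least_mem; exists k0.+1; split=> //; exists a, (-1) => k /ltnW; exact: vL.
rewrite -[least P]/(v_stab L) stab => -[_ [a' [b vab]]] k k1.
(* Two consecutive values determine the slope and the constant of the linear function. *)
have [] := (vL k0.+1 (leqnSn _), vL k0.+2 (leqW (leqnSn _))).
rewrite !vab // -(addn1 k0.+1) PoszD !mulrDr !mulr1 => e1 e2.
have -> : a' = a by lia.
by have -> : b = -1 by lia.
Qed.

(** All $c_j$ with $j \ne j_0$ equal $k_1$, and $c_{j_0}$ is solved from $1+\sum_j(c_j-1)=k$. The
    lower bound on $k$ makes $c_{j_0}\ge k_1$, so the linear formula applies to every $c_j$. *)
Lemma upset_v_number_sum_le (K : fieldType) (n t : nat) (U : 'I_t -> set 'X_{1..n})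
    (V : 'I_t -> pred 'I_n) (alpha : 'I_t -> nat) (k1 k : nat) (j0 : 'I_t) :
  (forall j, upset (U j)) -> (forall j, ~ U j 0%MM) ->
  (forall j m, U j m -> U j (restr (V j) m)) ->
  (forall i j x, V i x -> V j x -> i = j) -> (forall j, exists m, U j m) ->
  (0 < k1)%N -> (k1 + t.-1 * k1.-1 <= k)%N ->
  (forall j l, (k1 <= l)%N ->
     (v_number (mspan (mpow (U j) l) : set {mpoly K[n]}))%:Z = (alpha j)%:Z * l%:Z - 1) ->
  (v_number (mspan (mpow [set m | exists j, U j m] k) : set {mpoly K[n]}))%:Z <=
    (alpha j0)%:Z * (k - t.-1 * k1.-1)%N%:Z +
      (\sum_(j < t | j != j0) (alpha j)%:Z) * k1%:Z - t%:Z.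
Proof.
move=> upU nU0 UV dV Une k1_gt0 kge vU.
pose c j := if j == j0 then (k - t.-1 * k1.-1)%N else k1.
have ck1 j : (k1 <= c j)%N by rewrite /c; case: ifP => // _; lia.
have c_gt0 j : (0 < c j)%N by apply: leq_trans (ck1 j).
have nUc j : ~ mpow (U j) (c j) 0%MM.
  by move=> /(mordP _ _ (@nU0 j)); rewrite leqNgt mord0 c_gt0.
pose J j : set {mpoly K[n]} := mspan (mpow (U j) (c j)).
have exu j : exists u, is_prime_ideal (colon (J j) 'X_[u]) /\ mdeg u = v_number (J j).
  by have [u] := v_number_attained K (@mpow_upset _ (U j) (c j)) (nUc j); exists u.
have [u uP] := choice exu.
have cE : (\sum_j (c j).-1).+1 = k.
  rewrite (bigD1 j0) //= {1}/c eqxx.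
  rewrite (eq_bigr (fun=> k1.-1)) => [|j /negPf jj0]; last by rewrite /c jj0.
  rewrite sum_nat_const cardC1 card_ord; lia.
have := v_number_sum_le upU nU0 UV dV c_gt0 Une (fun j => (uP j).1).
rewrite cE -lez_nat => /le_trans; apply.
rewrite (big_morph Posz PoszD (erefl 0%:Z)).
rewrite (eq_bigr (fun j => (alpha j)%:Z * (c j)%:Z - 1)) => [|j _]; last first.
  by rewrite (uP j).2 vU.
rewrite sumrB sumr_const card_ord natz lerD2r (bigD1 j0) //= {1}/c eqxx lerD2l.
rewrite mulr_suml (eq_bigr (fun j => (alpha j)%:Z * k1%:Z)) // => j /negPf jj0.
by rewrite /c jj0.
Qed.

(** * The bound and its two equality cases *)

Theorem theorem5p2 (K : fieldType) (n t : nat) (ht : (0 < t)%N)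
    (I : 'I_t -> set {mpoly K[n]})
    (I_proper : forall j, is_proper_ideal (I j))
    (I_nonzero : forall j, exists2 f, I j f & f != 0)
    (I_monomial : forall j, monomial_ideal (I j))
    (supp_disjoint : forall i j, i != j -> supp (I i) `&` supp (I j) = set0)
    (v_eventual : exists k0 : nat, forall (k : nat) (j : 'I_t), (k0 <= k)%N ->
       (v_number (ideal_pow (I j) k))%:Z = (initial_degree (I j))%:Z * k%:Z - 1) :
  let alpha j := initial_degree (I j) in
  let a := alpha [arg min_(j < Ordinal ht) alpha j] in
  let bound (k : nat) : int :=
    a%:Z * k%:Z + (\sum_j (alpha j)%:Z - a%:Z - t%:Z) in
  let v (k : nat) : int := (v_number (ideal_pow (ideal_sum I) k))%:Z in
  [/\ forall k : nat, (1 <= k)%N -> bound k <= v k,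
      (forall i j, alpha i = alpha j) ->
        exists k0 : nat, forall k : nat, (k0 <= k)%N -> v k = bound k
    & (forall j, v_stab (I j) = 1%N) ->
        forall k : nat, (1 <= k)%N -> v k = bound k].
Proof.
have exU j : exists U : set 'X_{1..n}, upset U /\ I j = mspan U.
  by have [U] := monomial_idealP (I_monomial j); exists U.
have [U UP] := choice exU.
have [upU eI] : (forall j, upset (U j)) /\ I = fun j => mspan (U j).
  by split=> [j|]; [exact: (UP j).1|apply/funext => j; exact: (UP j).2].
clear UP exU I_monomial; subst I; move=> alpha a bound v.
pose V j := in_supp (mspan (U j) : set {mpoly K[n]}).
have UV j m : U j m -> U j (restr (V j) m) by exact: upset_restr_supp.
have dV i j x : V i x -> V j x -> i = j.
  move=> /asboolP Vi /asboolP Vj; apply/eqP; apply: contrapT => /negP /supp_disjoint.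
  by move=> /(congr1 (fun A => A x)); rewrite /setI /= => e; have : False by rewrite -e.
have nU0 j : ~ U j 0%MM.
  have [_ + _] := I_proper j => /negP n1 U0; apply: n1; apply/mem_set.
  by rewrite -mpolyX0; exact/mspanX.
have Une j : exists m, U j m.
  by have [f If f0] := I_nonzero j; exists (mlead f); apply: If; exact: mlead_supp.
have Ualpha j m : U j m -> (alpha j <= mdeg m)%N.
  move=> Um; apply: least_le; exists 'X_[m]; split; first exact/mspanX.
    by rewrite -msupp_eq0 msuppX.
  by rewrite dhomogX.
have aE j : (a <= alpha j)%N by rewrite /a; case: arg_minnP => // i _; exact.
pose W := [set m | exists j, U j m].
have vE k : v k = (v_number (mspan (mpow W k) : set {mpoly K[n]}))%:Z.
  by rewrite /v ideal_sum_mspan // ideal_pow_mspan.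
have lower k : (1 <= k)%N -> bound k <= v k.
  move=> k_gt0; rewrite vE.
  have nW0 : ~ mpow W k 0%MM.
    move=> /(mpow_union _ _ nU0 UV dV).
    by rewrite big1 => [|j _]; [case: k k_gt0|exact: mord0].
  have [u up <-] := v_number_attained K (@mpow_upset _ W k) nW0.
  have [o [ok deg_u]] := colon_mpow_lower upU nU0 UV dV ht k_gt0 Une Ualpha up.
  suff : (a * k + \sum_j alpha j <= mdeg u + t + a)%N.
    by rewrite /bound -(big_morph Posz PoszD (erefl 0%:Z)); lia.
  (* The $o_j$ sum to $k-1$, so the left side is $a(k-1)$, which accounts for the $-a$ in the
     bound. *)
  have ao : (a * \sum_j o j <= \sum_j alpha j * o j)%N.
    by rewrite big_distrr leq_sum // => j _; rewrite leq_mul2r aE orbT.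
  have eo : (\sum_j alpha j * (o j).+1 = \sum_j alpha j + \sum_j alpha j * o j)%N.
    by rewrite -big_split; apply: eq_bigr => j _; rewrite mulnS.
  by rewrite -ok mulnS; lia.
have upper k1 k j0 : (0 < k1)%N -> (k1 + t.-1 * k1.-1 <= k)%N ->
    (forall j l, (k1 <= l)%N ->
      (v_number (ideal_pow (mspan (U j)) l : set {mpoly K[n]}))%:Z =
        (alpha j)%:Z * l%:Z - 1) ->
    v k <= (alpha j0)%:Z * (k - t.-1 * k1.-1)%N%:Z +
             (\sum_(j < t | j != j0) (alpha j)%:Z) * k1%:Z - t%:Z.
  move=> k1_gt0 kge vU; rewrite vE.
  apply: (@upset_v_number_sum_le _ _ _ _ V) => // j l lge.
  by rewrite -ideal_pow_mspan vU.
pose j0 := [arg min_(j < Ordinal ht) alpha j].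
split=> // [eq_alpha|stab k k_gt0].
  have [k0 vk0] := v_eventual.
  (* This is the threshold of [upper] for $k_1=k_0+1$, where the successor makes $k_1$ positive. *)
  exists (k0.+1 + t.-1 * k0)%N => k kge.
  have k_gt0 : (0 < k)%N by lia.
  apply/le_anti; rewrite lower // andbT.
  apply: le_trans (upper k0.+1 k j0 _ kge _) _ => // [j l /ltnW lge|]; first exact: vk0.
  have ea j : (alpha j)%:Z = a%:Z by rewrite (eq_alpha j j0).
  rewrite /bound ea !(eq_bigr (fun=> a%:Z) (fun j _ => ea j)) !sumr_const cardC1 card_ord.
  rewrite -[_ *+ t]mulr_natr -[_ *+ t.-1]mulr_natr !natz /=.
  (* The truncated subtraction and [t.-1] become free variables, leaving a polynomial comparison
     over the integers. *)
  have : k = ((k - t.-1 * k0) + t.-1 * k0)%N by lia.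
  move: (k - _)%N => d ->; have : t%:Z = t.-1%:Z + 1 by lia.
  move: (t%:Z) t.-1 => t1 t2 ->; rewrite PoszD PoszM intS; lia.
apply/le_anti; rewrite lower // andbT.
have [k0 vk0] := v_eventual.
(* With $k_1=1$ every $c_j$ with $j\ne j_0$ is $1$ and $c_{j_0}=k$, so there is no threshold on $k$
   beyond $k\ge1$. Taking $j_0$ to minimize $\alpha$ gives slope $a$. *)
apply: le_trans (upper 1%N k j0 _ _ _) _ => // [|j l l_gt0|].
- by rewrite muln0 addn0.
- by apply: (@v_stab1_linear _ _ _ _ k0) => // l' /vk0.
- rewrite /bound muln0 subn0 mulr1 [in X in _ <= X](bigD1 j0) //=.
  have -> : alpha j0 = a by [].
  by rewrite [(a%:Z + _)%R]addrC addrK addrA.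
Qed.
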